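(* Let $q,r,\mu,\nu$ be positive integers with $q+1\le\nu\le q+r-1$. Then: (i) $\mathcal{N}^k(z)\bar{\mathcal{K}}^i(z)=0$ for all integers $i\ge k\ge0$; (ii) if $\mu\le r-1$, $\bar{\mathcal{K}}^{\mu-1}(z)$ has size $\nu r\times(\nu r-q\mu)$ and full column rank $\nu r-q\mu$, and if $\mu\ge r$, $\bar{\mathcal{K}}^{\mu-1}(z)$ has size $\nu r\times(\nu-q)r$ and full column rank $(\nu-q)r$; (iii) the kernel of $\mathcal{N}(z)$ has dimension $\nu r-q\min\{\mu,r\}$ and is spanned by the columns of $\bar{\mathcal{K}}^{\mu-1}(z)$; the rank of $\mathcal{N}(z)$ equals $q\min\{\mu,r\}<\nu r$, so $\mathcal{N}(z)$ never has full column rank.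
   Context: Matrix indices start at $0$; $'$ and $^{(j)}$ denote $z$-derivatives. $u(z)=(1,\dots,z^{q-1})^\top$, $w(z)=(1,\dots,z^{r-1})$, $M(z)=u(z)w(z)$. For $k\ge0$, $\mathcal{N}^k(z)=\frac{1}{k!}\big(\frac{1}{0!}M^{(k)}(z),\frac{1}{1!}M^{(k+1)}(z),\dots,\frac{1}{(\nu-1)!}M^{(k+\nu-1)}(z)\big)\in\mathbb{C}^{q\times\nu r}$, and $\mathcal{N}(z)\in\mathbb{C}^{\mu q\times\nu r}$ is the matrix with block rows $\mathcal{N}^0(z),\dots,\mathcal{N}^{\mu-1}(z)$. $S_n$ is the $n\times n$ shift matrix $(S_n)_{ij}=\delta_{i+1,j}$; $\ell_q$ is the last standard basis vector of $\mathbb{R}^q$, $\varphi$ the first standard basis vector of $\mathbb{R}^{\nu-q}$. $G(z)\in\mathbb{C}^{r\times r}$ has entries $G_{ij}=z^{j-i-1}$ for $j>i$, $0$ otherwise; for $0\le j\le r-1$, $G_{j0}(z)$ is the $(r-j)\times r$ matrix formed by the first $r-j$ rows of $G(z)$. For $0\le j\le r-2$, $F_j(z)\in\mathbb{C}^{(r-j)\times(r-j-1)}$ has entries $(F_j)_{ii}=-z$, $(F_j)_{i+1,i}=1$, zero otherwise. Define \[ \bar K_j(z)=\begin{pmatrix} I_q\otimes F_j(z)+S_q\otimes F_j'(z) & -(\ell_q\varphi^\top)\otimes \frac{1}{j!}G_{j0}^{(j)}(z)\\ 0 & I_{\nu-q}\otimes I_r-S_{\nu-q}\otimes G(z)\end{pmatrix}\in\mathbb{C}^{(\nu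 r-qj)\times(\nu r-q(j+1))}\quad(0\le j\le r-2), \] $\bar K_{r-1}(z)=\begin{pmatrix}0_{q\times(\nu-q)r}\\ I_{\nu-q}\otimes I_r-S_{\nu-q}\otimes G(z)\end{pmatrix}\in\mathbb{C}^{(\nu r-q(r-1))\times(\nu-q)r}$, and $\bar K_j(z)=I_{\nu-q}\otimes I_r-S_{\nu-q}\otimes G(z)$ for $j\ge r$. Finally $\bar{\mathcal{K}}^i(z)=\bar K_0(z)\bar K_1(z)\cdots\bar K_i(z)$. *)

(* Defs.v *)
From HB Require Import structures.
From mathcomp Require Import all_boot all_order all_algebra.
From mathcomp Require Import complex.
From mathcomp Require Import reals.
Set Implicit Arguments. Unset Strict Implicit. Unset Printing Implicit Defensive.
Import Order.TTheory GRing.Theory Num.Theory.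
Local Open Scope ring_scope.

(* Conventions: all indices start at 0.  Matrices whose entries depend on z
   are described by nat-indexed entry functions (nat -> nat -> F), and only
   turned into MathComp matrices of the right size at the end.  All
   z-derivatives are formal derivatives of the polynomial entries
   (p^`(n) = n-th derivative in {poly F}), evaluated at z afterwards. *)

Section Defs.
Variable F : fieldType.
Variables (q r nu : nat) (z : F).

Local Notation fn := (nat -> nat -> F).

Definition zerof : fn := fun _ _ => 0.
Definition idf : fn := fun i k => (i == k)%:R.
Definition shiftf : fn := fun i k => (i.+1 == k)%:R.
Definition kronf (m2 n2 : nat) (A B : fn) : fn :=
  fun i k => A (i %/ m2)%N (k %/ n2)%N * B (i %% m2)%N (k %% n2)%N.
Definition blockf (m1 n1 : nat) (UL UR DL DR : fn) : fn :=
  fun i k => if (i < m1)%N then (if (k < n1)%N then UL i k else UR i (k - n1)%N)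
             else (if (k < n1)%N then DL (i - m1)%N k else DR (i - m1)%N (k - n1)%N).
Definition addf (A B : fn) : fn := fun i k => A i k + B i k.
Definition subf (A B : fn) : fn := fun i k => A i k - B i k.
Definition oppf (A : fn) : fn := fun i k => - A i k.

(* M(z) = u(z) w(z), entries z^(a+b) as polynomials *)
Definition Mpoly (a b : nat) : {poly F} := 'X^(a + b).

Definition Nk_f (k : nat) : fn := fun a c =>
  let j := (c %/ r)%N in let b := (c %% r)%N in
  ((k`!)%:R^-1 * (j`!)%:R^-1) * ((Mpoly a b)^`(k + j)).[z].
Definition Nk (k : nat) : 'M[F]_(q, nu * r) := \matrix_(a < q, c < nu * r) Nk_f k a c.
Definition Ncal (mu : nat) : 'M[F]_(mu * q, nu * r) :=
  \matrix_(i < mu * q, c < nu * r) Nk_f (i %/ q)%N (i %% q)%N c.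

Definition Gpoly (i j : nat) : {poly F} := if (i < j)%N then 'X^(j - i - 1) else 0.
Definition Gf : fn := fun i j => (Gpoly i j).[z].
(* (1/j!) G^{(j)}(z); G_{j0} = its first r-j rows (the row restriction is
   enforced by the Kronecker product below, which uses r-j rows) *)
Definition Gjf (j : nat) : fn := fun a b => ((j`!)%:R^-1 *: (Gpoly a b)^`(j)).[z].
Definition Fpoly (a b : nat) : {poly F} :=
  if a == b then - 'X else if a == b.+1 then 1 else 0.
Definition Ff : fn := fun a b => (Fpoly a b).[z].
Definition Ffd : fn := fun a b => ((Fpoly a b)^`()).[z].
Definition lphif : fn := fun a b => ((a == q.-1) && (b == 0%N))%:R.

Definition Ibotf : fn := subf (kronf r r idf idf) (kronf r r shiftf Gf).

Definition Kbar_f (j : nat) : fn :=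
  if (j.+2 <= r)%N then
    blockf (q * (r - j)) (q * (r - j - 1))
      (addf (kronf (r - j) (r - j - 1) idf Ff) (kronf (r - j) (r - j - 1) shiftf Ffd))
      (oppf (kronf (r - j) r lphif (Gjf j)))
      zerof
      Ibotf
  else if j == r.-1 then
    fun a b => if (a < q)%N then 0 else Ibotf (a - q)%N b
  else Ibotf.

Definition dK (j : nat) : nat :=
  if j is 0 then (nu * r)%N else (nu * r - q * minn j r)%N.

Definition Kbar (j : nat) : 'M[F]_(dK j, dK j.+1) :=
  \matrix_(a < dK j, b < dK j.+1) Kbar_f j a b.

Fixpoint Kcal (i : nat) : 'M[F]_(dK 0, dK i.+1) :=
  match i with
  | 0 => Kbar 0
  | i'.+1 => Kcal i' *m Kbar i'.+1
  end.

End Defs.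

(* Main.v *)
(** Read a vector of length nu * r as polynomials p_0, ..., p_(nu-1) of degree
    less than r, so that N^k sends it to
      1/k! * sum_j 1/j! * (u p_j)^(k+j) (z).
    The matrix G is the divided difference p |-> (p - p(z)) / (X - z), the
    matrix G^(j) / j! is its (j+1)-fold iterate, and F_j is multiplication by
    X - z.
    Let N_m^k be N^k with the block p_j, j >= q, replaced by its m-th divided
    difference and the blocks p_j, j < q, restricted to degree less than r - m.
    The Leibniz rule for (X - z) * p at z then gives N_m^(k+1) K_m = N_(m+1)^k
    and N_m^0 K_m = 0. Since K_m has full column rank and N_m^0 has rank q for
    m < r, counting dimensions shows that the kernel of N_m^0 is the image of
    K_m, and everything follows by telescoping the product K_0 ... K_i. *)
Require Import Defs.
From HB Require Import structures.
From mathcomp Require Import all_boot all_order all_algebra.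
From mathcomp Require Import zify ring.
From mathcomp Require Import complex.
From mathcomp Require Import reals.
Import Order.TTheory GRing.Theory Num.Theory.
Local Open Scope ring_scope.

Set Implicit Arguments.
Unset Strict Implicit.
Unset Printing Implicit Defensive.

(** * Divided differences at z and scaled derivatives at z *)

Section DividedDifference.
Variables (F : numFieldType) (z : F).
Implicit Types (p : {poly F}).

Lemma factr_neq0 n : (n`!)%:R != 0 :> F.
Proof. by rewrite pnatr_eq0 -lt0n fact_gt0. Qed.

(** Leibniz rule: derivatives of X - z beyond the first vanish. At n = 0 the truncated [n.-1] is
    harmless, its term being taken 0 times. *)
Lemma derivn_XsubCM n p :
  (('X - z%:P) * p)^`(n) = ('X - z%:P) * p^`(n) + p^`(n.-1) *+ n.
Proof.
elim: n => [|n IHn]; first by rewrite mulr0n addr0.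
rewrite derivnS IHn derivD derivM derivXsubC mul1r derivMn -!derivnS mulrS.
by rewrite [p^`(n) + _]addrC -addrA; case: n {IHn} => [|n].
Qed.

Lemma horner_derivn_XsubCM n p :
  (('X - z%:P) * p)^`(n).[z] = n%:R * p^`(n.-1).[z].
Proof.
rewrite derivn_XsubCM hornerD hornerM hornerXsubC subrr mul0r add0r.
by rewrite hornerMn mulr_natl.
Qed.

Definition ddiff p : {poly F} := p %/ ('X - z%:P).

Lemma ddiffE p : p = ('X - z%:P) * ddiff p + p.[z]%:P.
Proof. by rewrite {1}(divp_eq p ('X - z%:P)) modp_XsubC mulrC. Qed.

Lemma ddiff_uniq p s c : p = ('X - z%:P) * s + c%:P -> ddiff p = s.
Proof.
move=> ->; rewrite mulrC /ddiff divp_addl_mul_small // size_XsubC.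
by rewrite (leq_ltn_trans (size_polyC_leq1 c)).
Qed.

Lemma ddiffC c : ddiff c%:P = 0.
Proof. by apply: (@ddiff_uniq _ _ c); rewrite mulr0 add0r. Qed.

Lemma ddiffD p s : ddiff (p + s) = ddiff p + ddiff s.
Proof. exact: divpD. Qed.

Lemma ddiffZ c p : ddiff (c *: p) = c *: ddiff p.
Proof. exact: divpZl. Qed.

Lemma ddiff_mulX p : ddiff ('X * p) = 'X * ddiff p + p.[z]%:P.
Proof.
(* The remainder must be the value of X p at z. *)
apply: (@ddiff_uniq _ _ (z * p.[z])).
by rewrite {1}(ddiffE p) polyCM; ring.
Qed.

Lemma iter_ddiffD m p s :
  iter m ddiff (p + s) = iter m ddiff p + iter m ddiff s.
Proof. by elim: m => //= m ->; rewrite ddiffD. Qed.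

Lemma iter_ddiffZ m c p : iter m ddiff (c *: p) = c *: iter m ddiff p.
Proof. by elim: m => //= m ->; rewrite ddiffZ. Qed.

Lemma iter_ddiff_sum m n (c : nat -> F) (p : nat -> {poly F}) :
  iter m ddiff (\sum_(i < n) c i *: p i) = \sum_(i < n) c i *: iter m ddiff (p i).
Proof.
elim: n => [|n IHn]; last by rewrite !big_ord_recr iter_ddiffD IHn iter_ddiffZ.
by rewrite !big_ord0; elim: m => //= m ->; rewrite -[0]polyC0 ddiffC.
Qed.

(** The constant produced at each step is killed by the next division, so only the last one
    survives. *)
Lemma iter_ddiff_mulX m p :
  iter m.+1 ddiff ('X * p) = 'X * iter m.+1 ddiff p + (iter m ddiff p).[z]%:P.
Proof.
elim: m => [|m IHm]; first exact: ddiff_mulX.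
by rewrite iterS IHm ddiffD ddiffC addr0 ddiff_mulX.
Qed.

Lemma iter_ddiff1 m : iter m.+1 ddiff 1 = 0.
Proof.
by elim: m => [|m IHm]; [exact: (ddiffC 1) | rewrite iterS IHm -[0]polyC0 ddiffC].
Qed.

(** The m-fold divided difference of p takes at z the value p^(m)(z) / m!; for monomials the
    induction is Pascal's rule. *)
Lemma horner_iter_ddiffXn m b :
  (iter m ddiff 'X^b).[z] = ('C(b, m))%:R * z ^+ (b - m).
Proof.
elim: b m => [|b IHb] [|m].
- by rewrite bin0 hornerC mul1r.
- by rewrite expr0 iter_ddiff1 horner0 mul0r.
- by rewrite bin0 hornerXn mul1r.
rewrite exprS iter_ddiff_mulX hornerD hornerM hornerX hornerC !IHb binS natrD.
rewrite mulrDl subSS; congr (_ + _).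
have [lt_mb|le_bm] := ltnP m b; last by rewrite bin_small // !mul0r mulr0.
by rewrite mulrCA -exprS subnSK.
Qed.

Lemma GjfE m i b :
  Gjf z m i b = if (i < b)%N then ('C(b - i - 1, m))%:R * z ^+ (b - i - 1 - m) else 0.
Proof.
rewrite /Gjf /Gpoly; case: ifP => _.
  rewrite hornerZ derivnXn hornerMn hornerXn -[_ ^+ _ *+ _]mulr_natl -bin_ffact natrM.
  by rewrite -mulrA mulrCA mulKf ?factr_neq0.
by rewrite linear0 scaler0 horner0.
Qed.

(** Multiplying by X shifts the coefficients by one, which matches the dependence of G on b - i
    only; the new coefficient 0 is the value at z computed above. *)
Lemma coef_iter_ddiffXn m b i : (iter m.+1 ddiff 'X^b)`_i = Gjf z m i b.
Proof.
elim: b i => [|b IHb] i; first by rewrite iter_ddiff1 coef0 GjfE.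
rewrite exprS iter_ddiff_mulX coefD coefXM coefC horner_iter_ddiffXn.
case: i => [|i] /=; first by rewrite add0r GjfE subn0 subSS subn0.
by rewrite addr0 IHb !GjfE ltnS subSS.
Qed.

(** The (m+1)-fold divided difference of X^b has degree at most b - m - 1 < n, so the first n rows
    hold all its coefficients. With n = r - m this is why G_{j0} keeps only r - j rows. *)
Lemma sum_Gjf m b n : (b <= m + n)%N ->
  \sum_(i < n) Gjf z m i b *: 'X^i = iter m.+1 ddiff 'X^b.
Proof.
move=> le_b; rewrite -(poly_def n (fun i => Gjf z m i b)); apply/polyP=> i.
rewrite coef_poly coef_iter_ddiffXn; case: ltnP => // le_ni.
rewrite GjfE; case: ifP => // lt_ib; rewrite bin_small ?mul0r //; lia.
Qed.

Lemma Gf_Gjf i b : Gf z i b = Gjf z 0 i b.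
Proof. by rewrite /Gjf fact0 invr1 scale1r. Qed.

Lemma sum_Gf_ddiff m b n : (b <= n)%N ->
  \sum_(i < n) Gf z i b *: iter m ddiff 'X^i = iter m.+1 ddiff 'X^b.
Proof.
move=> le_bn; rewrite -(iter_ddiff_sum m n (Gf z ^~ b) (fun i => 'X^i)).
under eq_bigr do rewrite Gf_Gjf.
by rewrite sum_Gjf // -iterSr.
Qed.

Definition taylor_coef a k j p : F :=
  (k`!)%:R^-1 * (j`!)%:R^-1 * ('X^a * p)^`(k + j).[z].

Lemma taylor_coef_sum a k j n (c : nat -> F) (p : nat -> {poly F}) :
  taylor_coef a k j (\sum_(i < n) c i *: p i)
    = \sum_(i < n) taylor_coef a k j (p i) * c i.
Proof.
rewrite /taylor_coef mulr_sumr linear_sum horner_sum mulr_sumr.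
by apply: eq_bigr => i _; rewrite -scalerAr linearZ /= hornerZ; ring.
Qed.

(** At least j > a derivatives fall on c X^a. Hence blocks j >= q ignore constants, and there p may
    be replaced by (X - z) times its divided difference. *)
Lemma taylor_coefC a k j c : (a < j)%N -> taylor_coef a k j c%:P = 0.
Proof.
move=> lt_aj; rewrite /taylor_coef [_ * c%:P]mulrC mul_polyC linearZ /= derivnXn.
by rewrite ffact_small ?mulr0n ?scaler0 ?horner0 ?mulr0 //; lia.
Qed.

Lemma taylor_coefD a k j p s :
  taylor_coef a k j (p + s) = taylor_coef a k j p + taylor_coef a k j s.
Proof. by rewrite /taylor_coef mulrDr linearD hornerD mulrDr. Qed.

Lemma taylor_coefZ a k j c p : taylor_coef a k j (c *: p) = c * taylor_coef a k j p.
Proof. by rewrite /taylor_coef -scalerAr linearZ /= hornerZ mulrCA. Qed.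

Lemma taylor_coef_XsubCM0 a k p :
  taylor_coef a k 0 (('X - z%:P) * p) = if k is k'.+1 then taylor_coef a k' 0 p else 0.
Proof.
rewrite /taylor_coef mulrCA horner_derivn_XsubCM addn0.
case: k => [|k]; first by rewrite mul0r mulr0.
rewrite /= addn0 factS natrM; field.
by rewrite !factr_neq0 nat1r pnatr_eq0.
Qed.

(** Leibniz leaves the factor k + j + 1 = k + (j + 1). The share j + 1 reduces (j + 1)! to j! and
    gives the subtracted term; the share k reduces k! to (k - 1)! and is absent when k = 0. *)
Lemma taylor_coef_XsubCMS a k j p :
  taylor_coef a k j.+1 (('X - z%:P) * p) - taylor_coef a k j p
    = if k is k'.+1 then taylor_coef a k' j.+1 p else 0.
Proof.
rewrite /taylor_coef mulrCA horner_derivn_XsubCM addnS /=.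
case: k => [|k].
  rewrite add0n factS natrM; apply/eqP; rewrite subr_eq0; apply/eqP; field.
  by rewrite !factr_neq0 ?nat1r ?pnatr_eq0.
rewrite addSn addnS !factS !natrM -!natr1 natrD; field.
by rewrite !(factr_neq0, pnatr_eq0, natr1, nat1r).
Qed.

End DividedDifference.

(** * Sums and indices of block matrices *)

Lemma sum_delta (V : pzRingType) n j (g : nat -> V) :
  \sum_(i < n) ((i : nat) == j)%:R * g i = if (j < n)%N then g j else 0.
Proof.
case: ifP => [lt_jn|ge_jn].
  rewrite (bigD1 (Ordinal lt_jn)) //= eqxx mul1r big1 ?addr0 // => i.
  by rewrite -val_eqE /= => /negPf->; rewrite mul0r.
apply: big1 => i _; case: eqP => [def_i|_]; last by rewrite mul0r.
by rewrite -def_i ltn_ord in ge_jn.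
Qed.

Lemma sum_ord_mul (V : nmodType) m n (f : nat -> V) :
  \sum_(i < m * n) f i = \sum_(i < m) \sum_(j < n) f (i * n + j)%N.
Proof.
elim: m => [|m IHm]; first by rewrite mul0n !big_ord0.
by rewrite mulSn addnC big_split_ord /= IHm big_ord_recr.
Qed.

Lemma divn_block s j b : (b < s)%N -> ((j * s + b) %/ s)%N = j.
Proof. by move=> lt_bs; rewrite divnMDl ?divn_small ?addn0 //; case: s lt_bs. Qed.

Lemma modn_block s j b : (b < s)%N -> ((j * s + b) %% s)%N = b.
Proof. by move=> lt_bs; rewrite modnMDl modn_small. Qed.

Lemma ltn_block q s j b : (j < q)%N -> (b < s)%N -> (j * s + b < q * s)%N.
Proof. by nia. Qed.

(** * Block description of K_m *)

Section Stage.
Variables (F : numFieldType) (q r nu : nat) (z : F).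
Hypotheses (q_gt0 : (0 < q)%N) (r_gt0 : (0 < r)%N) (lt_q_nu : (q < nu)%N).

Local Notation dim := (dK q r nu).
Local Notation K := (Kbar_f q r z).

(** There are q top blocks of length r - m and nu - q bottom blocks of length r; truncated
    subtraction covers m >= r, where the top blocks are empty. *)
Lemma dKE m : dim m = (q * (r - m) + (nu - q) * r)%N.
Proof. by case: m => [|m]; rewrite /dK; nia. Qed.

Variant block_index m : nat -> Prop :=
| TopIndex j b of (j < q)%N & (b < r - m)%N : block_index m (j * (r - m) + b)
| BotIndex j b of (j < nu - q)%N & (b < r)%N :
    block_index m (q * (r - m) + (j * r + b)).

Lemma block_indexP m c : (c < dim m)%N -> block_index m c.
Proof.
rewrite dKE => lt_c; have [lt_c_top|ge_c_top] := ltnP c (q * (r - m)).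
  have s_gt0 : (0 < r - m)%N by case: (r - m)%N lt_c_top => //; rewrite muln0.
  by rewrite (divn_eq c (r - m)); apply: TopIndex; rewrite ?ltn_mod ?ltn_divLR.
rewrite -(subnKC ge_c_top) (divn_eq (c - _) r).
by apply: BotIndex; rewrite ?ltn_mod ?ltn_divLR // ltn_subLR.
Qed.

Lemma sum_dK (V : nmodType) m (f : nat -> V) :
  \sum_(i < dim m) f i
    = \sum_(j < q) \sum_(b < r - m) f (j * (r - m) + b)%N
      + \sum_(j < nu - q) \sum_(b < r) f (q * (r - m) + (j * r + b))%N.
Proof.
by rewrite dKE big_split_ord /= sum_ord_mul (sum_ord_mul _ _ (fun i => f (_ + i)%N)).
Qed.

(** One block formula serves all three cases. At m = r - 1 the left blocks have no columns and the
    upper right one vanishes, since 'C(b - 1, r - 1) = 0 for 0 < b < r; for m >= r the upper rows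
    disappear as well. *)
Lemma Kbar_fE m :
  K m =2 blockf (q * (r - m)) (q * (r - m.+1))
    (Defs.addf (kronf (r - m) (r - m.+1) (idf F) (Ff z))
          (kronf (r - m) (r - m.+1) (shiftf F) (Ffd z)))
    (Defs.oppf (kronf (r - m) r (lphif F q) (Gjf z m))) (zerof F) (Ibotf r z).
Proof.
move=> a b; rewrite /Kbar_f; case: ifP => [_|ge_m]; first by rewrite -subnDA addn1.
case: eqP => [def_m|neq_m].
  have -> : (r - m = 1)%N by lia.
  have -> : (r - m.+1 = 0)%N by lia.
  rewrite /blockf muln0 muln1 ltn0 subn0; case: ifP => // _.
  rewrite /Defs.oppf /kronf modn1 GjfE; case: ifP => [gt0_b|_].
    by rewrite bin_small ?mul0r ?mulr0 ?oppr0 //; have := ltn_pmod b r_gt0; lia.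
  by rewrite mulr0 oppr0.
have -> : (r - m = 0)%N by lia.
have -> : (r - m.+1 = 0)%N by lia.
by rewrite /blockf muln0 !ltn0 !subn0.
Qed.

Lemma Kbar_TT m i a j b :
    (i < q)%N -> (a < r - m)%N -> (j < q)%N -> (b < r - m.+1)%N ->
  K m (i * (r - m) + a) (j * (r - m.+1) + b)
    = (i == j)%:R * Ff z a b + (i.+1 == j)%:R * Ffd z a b.
Proof.
move=> lt_iq lt_a lt_jq lt_b; rewrite Kbar_fE /blockf !ltn_block //.
by rewrite /Defs.addf /kronf !divn_block ?modn_block.
Qed.

Lemma Kbar_TB m i a j b :
    (i < q)%N -> (a < r - m)%N -> (b < r)%N ->
  K m (i * (r - m) + a) (q * (r - m.+1) + (j * r + b))
    = - (((i == q.-1) && (j == 0%N))%:R * Gjf z m a b).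
Proof.
move=> lt_iq lt_a lt_b; rewrite Kbar_fE /blockf ltn_block // ltnNge leq_addr /=.
by rewrite addKn /Defs.oppf /kronf !divn_block ?modn_block.
Qed.

Lemma Kbar_BT m i j b : (j < q)%N -> (b < r - m.+1)%N ->
  K m (q * (r - m) + i) (j * (r - m.+1) + b) = 0.
Proof.
by move=> lt_jq lt_b; rewrite Kbar_fE /blockf ltnNge leq_addr /= ltn_block.
Qed.

Lemma Kbar_BB m i a j b : (a < r)%N -> (b < r)%N ->
  K m (q * (r - m) + (i * r + a)) (q * (r - m.+1) + (j * r + b))
    = (i == j)%:R * (a == b)%:R - (i.+1 == j)%:R * Gf z a b.
Proof.
move=> lt_a lt_b; rewrite Kbar_fE /blockf !ltnNge !leq_addr /= !addKn.
by rewrite /Ibotf /subf /kronf !divn_block ?modn_block.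
Qed.

(** * The stage matrices N_m^k and their products with K_m *)

Lemma FfE a b : Ff z a b = (a == b.+1)%:R - z * (a == b)%:R.
Proof.
rewrite /Ff /Fpoly; case: eqP => [->|_].
  by rewrite hornerN hornerX eqn_leq ltnn andbF mulr1 sub0r.
by rewrite mulr0 subr0; case: eqP => _; rewrite ?horner0 ?hornerC.
Qed.

Lemma FfdE a b : Ffd z a b = - (a == b)%:R.
Proof.
rewrite /Ffd /Fpoly; case: eqP => [_|_]; first by rewrite derivN derivX hornerN hornerC.
by case: eqP => _; rewrite ?derivC horner0 oppr0.
Qed.


Lemma sum_Ff n b : (b.+1 < n)%N ->
  \sum_(l < n) Ff z l b *: 'X^l = ('X - z%:P) * 'X^b.
Proof.
move=> lt_bn.
(* The scalar deltas become polynomial factors, the form that [sum_delta] expects. *)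
under eq_bigr do rewrite FfE scalerBl -mulr_algl -scalerA -[_ *: 'X^_]mulr_algl.
under eq_bigr do rewrite -!in_algE !rmorph_nat.
rewrite sumrB -scaler_sumr !(sum_delta _ _ (fun l => 'X^l)) lt_bn (ltnW lt_bn).
by rewrite mulrBl -exprS mul_polyC.
Qed.

Lemma sum_Ffd n b : (b < n)%N -> \sum_(l < n) Ffd z l b *: 'X^l = (-1) *: 'X^b.
Proof.
move=> lt_bn; under eq_bigr do rewrite FfdE -mulN1r -scalerA -[_ *: 'X^_]mulr_algl.
under eq_bigr do rewrite -!in_algE !rmorph_nat.
by rewrite -scaler_sumr (sum_delta _ _ (fun l => 'X^l)) lt_bn.
Qed.

(* The matrix N_m^k of the header; N^k itself is the case m = 0. *)
Definition Nstage_f (m k a c : nat) : F :=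
  if (c < q * (r - m))%N then
    taylor_coef z a k (c %/ (r - m)) 'X^(c %% (r - m))
  else let c' := (c - q * (r - m))%N in
    taylor_coef z a k (q + c' %/ r) (iter m (ddiff z) 'X^(c' %% r)).

Definition Nstage m k : 'M[F]_(q, dim m) :=
  \matrix_(a < q, c < dim m) Nstage_f m k a c.

Lemma Nstage_T m k a j b : (j < q)%N -> (b < r - m)%N ->
  Nstage_f m k a (j * (r - m) + b) = taylor_coef z a k j 'X^b.
Proof.
by move=> lt_jq lt_b; rewrite /Nstage_f ltn_block // divn_block ?modn_block.
Qed.

Lemma Nstage_B m k a j b : (b < r)%N ->
  Nstage_f m k a (q * (r - m) + (j * r + b))
    = taylor_coef z a k (q + j) (iter m (ddiff z) 'X^b).
Proof.
move=> lt_b; rewrite /Nstage_f ltnNge leq_addr /= addKn.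
by rewrite divn_block ?modn_block.
Qed.

Lemma Nk_Nstage k : Nk q r nu z k = Nstage 0 k.
Proof.
apply/matrixP=> a c; rewrite !mxE /Nstage_f subn0 /Nk_f /Mpoly exprD.
case: ifP => //; rewrite ltnNge => /negbFE le_c.
by rewrite -{1 2 3}(subnKC le_c) divnMDl ?modnMDl.
Qed.

(** This column of K_m encodes (X - z) X^b in block j and, through S_q and F', -X^b in block j - 1:
    exactly the combination in the Leibniz identities. *)
Lemma sum_Nstage_Kbar_T m k a j b : (j < q)%N -> (b < r - m.+1)%N ->
  \sum_(i < dim m) Nstage_f m k a i * K m i (j * (r - m.+1) + b)
    = if k is k'.+1 then taylor_coef z a k' j 'X^b else 0.
Proof.
move=> lt_jq lt_b; have lt_b' : (b.+1 < r - m)%N by lia.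
rewrite (sum_dK m (fun i => Nstage_f m k a i * K m i (j * (r - m.+1) + b))).
rewrite [X in _ + X]big1 ?addr0; last first.
  by move=> i _; apply: big1 => l _; rewrite Kbar_BT ?mulr0.
have sum_row (i : 'I_q) : \sum_(l < r - m)
    Nstage_f m k a (i * (r - m) + l) * K m (i * (r - m) + l) (j * (r - m.+1) + b)
  = ((i : nat) == j)%:R * taylor_coef z a k i (('X - z%:P) * 'X^b)
    + ((i : nat).+1 == j)%:R * taylor_coef z a k i ((-1) *: 'X^b).
  rewrite -(sum_Ff lt_b') -(sum_Ffd (ltnW lt_b')).
  rewrite (taylor_coef_sum z a k i _ (Ff z ^~ b) (fun l => 'X^l)).
  rewrite (taylor_coef_sum z a k i _ (Ffd z ^~ b) (fun l => 'X^l)).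
  rewrite !mulr_sumr -big_split; apply: eq_bigr => l _ /=.
  by rewrite Nstage_T // Kbar_TT //; ring.
rewrite (eq_bigr _ (fun i _ => sum_row i)) big_split /=.
rewrite (sum_delta _ _ (fun i => taylor_coef z a k i (('X - z%:P) * 'X^b))) lt_jq.
case: j lt_jq {sum_row} => [|j] lt_jq.
  rewrite big1 ?addr0; last by move=> i _; rewrite mul0r.
  exact: taylor_coef_XsubCM0.
under [X in _ + X]eq_bigr do rewrite eqSS.
rewrite (sum_delta _ _ (fun i => taylor_coef z a k i ((-1) *: 'X^b))) (ltnW lt_jq).
by rewrite taylor_coefZ mulN1r taylor_coef_XsubCMS.
Qed.

(** Let p be the m-fold divided difference of X^b. The column contributes p to block q + j and minus
    the divided difference of p to block q + j - 1; up to a constant in p, this is again the Leibniz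
    combination. *)
Lemma sum_Nstage_Kbar_B m k a j b : (a < q)%N -> (j < nu - q)%N -> (b < r)%N ->
  \sum_(i < dim m) Nstage_f m k a i * K m i (q * (r - m.+1) + (j * r + b))
    = if k is k'.+1 then taylor_coef z a k' (q + j) (iter m.+1 (ddiff z) 'X^b) else 0.
Proof.
move=> lt_aq lt_j lt_b; have le_b : (b <= m + (r - m))%N by lia.
rewrite (sum_dK m (fun i => Nstage_f m k a i * K m i (q * (r - m.+1) + (j * r + b)))).
have sum_top (i : 'I_q) : \sum_(l < r - m)
    Nstage_f m k a (i * (r - m) + l)
      * K m (i * (r - m) + l) (q * (r - m.+1) + (j * r + b))
  = ((i : nat) == q.-1)%:R
      * ((j == 0%N)%:R * - taylor_coef z a k i (iter m.+1 (ddiff z) 'X^b)).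
  rewrite -(sum_Gjf z le_b) (taylor_coef_sum z a k i _ (Gjf z m ^~ b) (fun l => 'X^l)).
  rewrite -sumrN !mulr_sumr; apply: eq_bigr => l _ /=.
  by rewrite Nstage_T // Kbar_TB // -mulnb natrM; ring.
have sum_bot (i : 'I_(nu - q)) : \sum_(l < r)
    Nstage_f m k a (q * (r - m) + (i * r + l))
      * K m (q * (r - m) + (i * r + l)) (q * (r - m.+1) + (j * r + b))
  = ((i : nat) == j)%:R * taylor_coef z a k (q + i) (iter m (ddiff z) 'X^b)
    - ((i : nat).+1 == j)%:R * taylor_coef z a k (q + i) (iter m.+1 (ddiff z) 'X^b).
  rewrite -(sum_Gf_ddiff z m (ltnW lt_b)).
  rewrite (taylor_coef_sum z a k _ _ (Gf z ^~ b) (fun l => iter m (ddiff z) 'X^l)).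
  have := sum_delta r b (fun l => taylor_coef z a k (q + i) (iter m (ddiff z) 'X^l)).
  rewrite lt_b => <-.
  rewrite !mulr_sumr -sumrB; apply: eq_bigr => l _ /=.
  by rewrite Nstage_B // Kbar_BB //; ring.
rewrite (eq_bigr _ (fun i _ => sum_top i)) (eq_bigr _ (fun i _ => sum_bot i)) sumrB.
rewrite (sum_delta _ _ (fun i =>
  (j == 0%N)%:R * - taylor_coef z a k i (iter m.+1 (ddiff z) 'X^b))).
rewrite ltn_predL q_gt0 (sum_delta _ _ (fun i =>
  taylor_coef z a k (q + i) (iter m (ddiff z) 'X^b))) lt_j.
(* The constant p(z) drops out because a < q <= q + j. *)
rewrite (ddiffE z (iter m _ _)) -iterS taylor_coefD taylor_coefC ?ltn_addr // addr0.
rewrite -[in (q + j)%N](prednK q_gt0) addSn -taylor_coef_XsubCMS -addSn (prednK q_gt0).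
(* For j = 0 the preceding block is the top block q - 1, reached by the corner of K_m with G^(m) /
   m!; otherwise it is a bottom block, reached by the shift with G. *)
case: j lt_j {sum_top sum_bot} => [|j] lt_j.
  rewrite [X in _ - X]big1 ?subr0 => [|i _]; last by rewrite mul0r.
  by rewrite !addn0 mul1r addrC.
under [X in _ - X]eq_bigr do rewrite eqSS.
rewrite (sum_delta _ _ (fun i =>
  taylor_coef z a k (q + i) (iter m.+1 (ddiff z) 'X^b))) (ltnW lt_j).
by rewrite mul0r add0r [(q.-1 + _)%N]addnS -addSn (prednK q_gt0).
Qed.

Lemma mul_Nstage_Kbar m k :
  Nstage m k *m Kbar q r nu z m = if k is k'.+1 then Nstage m.+1 k' else 0.
Proof.
apply/matrixP=> a [c lt_c]; rewrite mxE.
under eq_bigr do rewrite !mxE /=.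
transitivity (if k is k'.+1 then Nstage_f m.+1 k' a c else 0); last first.
  by case: k => [|k]; rewrite mxE.
case: (block_indexP lt_c) => [j b lt_jq lt_b|j b lt_j lt_b].
  by rewrite sum_Nstage_Kbar_T //; case: k => // k; rewrite Nstage_T.
by rewrite sum_Nstage_Kbar_B //; case: k => // k; rewrite Nstage_B.
Qed.

(** Each factor raises the stage and lowers k by one; after k factors the order is 0 and the next
    factor annihilates. *)
Lemma Nstage_Kcal k i : Nk q r nu z k *m Kcal q r nu z i
  = if (k <= i)%N then 0 else Nstage i.+1 (k - i.+1).
Proof.
elim: i => [|i IHi].
  rewrite Nk_Nstage; apply: (etrans (mul_Nstage_Kbar 0 k)).
  by case: k => // k; rewrite subn1.
apply: (etrans (mulmxA _ _ _)); rewrite IHi.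
case: (ltngtP k i.+1) => [lt_ki|gt_ki|->].
- by rewrite -ltnS lt_ki mul0mx.
- rewrite leqNgt ltnW //; apply: (etrans (mul_Nstage_Kbar _ _)).
  by rewrite -[(k - i.+1)%N]prednK ?subn_gt0 // -subnS.
- by rewrite ltnn subnn; apply: mul_Nstage_Kbar.
Qed.

(** * Ranks of K_m and N_m^0 from unitriangular submatrices *)

Lemma row_free_unitrig m n (A : 'M[F]_(m, n)) (g : 'I_m -> 'I_n) :
    (forall i, A i (g i) = 1) ->
    (forall i j : 'I_m, (i < j)%N -> A i (g j) = 0) ->
  row_free A.
Proof.
move=> A_diag A_upper; pose B := \matrix_(i, j) A i (g j).
have B_unit : B \in unitmx.
  rewrite unitmxE det_trig ?big1 ?unitr1 // => [i _|]; first by rewrite mxE.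
  by apply/is_trig_mxP => i j lt_ij; rewrite mxE A_upper.
have def_B : B = A *m \matrix_(l, j) (l == g j)%:R.
  apply/matrixP=> i j; rewrite !mxE (bigD1 (g j)) //= mxE eqxx mulr1 big1 ?addr0 //.
  by move=> l /negPf ne_l; rewrite mxE ne_l mulr0.
rewrite -row_leq_rank; apply: leq_trans (_ : \rank B <= _)%N; last rewrite def_B.
  by rewrite mxrank_unit.
exact: mxrankM_maxl.
Qed.

(* The row of K_m holding the last nonzero entry of column c, which is 1; these
   rows form a unitriangular submatrix. *)
Definition pivot m c : nat :=
  if (c < q * (r - m.+1))%N
  then ((c %/ (r - m.+1)) * (r - m) + (c %% (r - m.+1)).+1)%N
  else (q * (r - m) + (c - q * (r - m.+1)))%N.

Lemma pivot_T m j b : (j < q)%N -> (b < r - m.+1)%N ->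
  pivot m (j * (r - m.+1) + b) = (j * (r - m) + b.+1)%N.
Proof.
by move=> lt_jq lt_b; rewrite /pivot ltn_block // divn_block ?modn_block.
Qed.

Lemma pivot_B m i : pivot m (q * (r - m.+1) + i) = (q * (r - m) + i)%N.
Proof. by rewrite /pivot ltnNge leq_addr /= addKn. Qed.

Lemma pivot_lt m c : (c < dim m.+1)%N -> (pivot m c < dim m)%N.
Proof.
case/block_indexP=> [j b lt_jq lt_b|j b lt_j lt_b].
  by rewrite pivot_T // dKE ltn_addr // ltn_block //; lia.
by rewrite pivot_B dKE ltn_add2l ltn_block.
Qed.

Lemma Kbar_pivot m c : (c < dim m.+1)%N -> K m (pivot m c) c = 1.
Proof.
case/block_indexP=> [j b lt_jq lt_b|j b lt_j lt_b].
  rewrite pivot_T // Kbar_TT //; last by lia.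
  by rewrite FfE !eqxx !gtn_eqF // mulr0 subr0 mulr1 mul0r addr0.
by rewrite pivot_B Kbar_BB // !eqxx gtn_eqF // mulr1 mul0r subr0.
Qed.

(** Apart from the 1 in column c, a pivot row has entries only further right: -z stands just after
    the 1 in F_m, the shifts reach the next block, and the corner block lies to the right. *)
Lemma Kbar_below_pivot m c d : (c < dim m.+1)%N -> (d < c)%N -> K m (pivot m c) d = 0.
Proof.
move=> lt_c lt_dc; have lt_d := ltn_trans lt_dc lt_c.
case: (block_indexP lt_d) lt_dc; case: (block_indexP lt_c).
- move=> i a lt_iq lt_a j b lt_jq lt_b lt_dc.
  rewrite pivot_T // Kbar_TT //; last by lia.
  rewrite FfE FfdE eqSS.
  case: (eqVneq i j) => [eq_ij|ne_ij].
    move: lt_dc; rewrite eq_ij ltn_add2l => lt_ba.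
    rewrite (gtn_eqF lt_ba) (gtn_eqF (leqW lt_ba)) (gtn_eqF (ltnSn j)).
    by rewrite !mulr0 subr0 mulr0 mul0r addr0.
  case: (i.+1 =P j) => [def_j|_]; first by subst j; exfalso; nia.
  by rewrite !mul0r addr0.
- by move=> i a lt_i lt_a j b lt_jq lt_b _; rewrite pivot_B Kbar_BT.
- move=> i a lt_iq lt_a j b lt_j lt_b lt_dc.
  have := ltn_trans lt_dc (ltn_block lt_iq lt_a).
  by rewrite ltnNge leq_addr.
- move=> i a lt_i lt_a j b lt_j lt_b; rewrite ltn_add2l => lt_dc.
  rewrite pivot_B Kbar_BB //; case: (eqVneq i j) => [eq_ij|ne_ij].
    move: lt_dc; rewrite eq_ij ltn_add2l => lt_ba.
    by rewrite (gtn_eqF lt_ba) (gtn_eqF (ltnSn j)) mulr0 mul0r subr0.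
  case: (i.+1 =P j) => [def_j|_]; first by subst j; exfalso; nia.
  by rewrite !mul0r subr0.
Qed.

Lemma rank_Kbar m : \rank (Kbar q r nu z m) = dim m.+1.
Proof.
rewrite -mxrank_tr; apply/eqP.
pose g (c : 'I_(dim m.+1)) := Ordinal (pivot_lt (ltn_ord c)).
apply: (@row_free_unitrig _ _ _ g) => [c|c d lt_cd]; rewrite !mxE /=.
  exact: Kbar_pivot.
exact: Kbar_below_pivot.
Qed.

(** The columns of X^0 in the q top blocks, present because m < r, form the lower unitriangular
    matrix with entries 'C(a, j) z^(a - j). *)
Lemma rank_Nstage m : (m < r)%N -> (q <= \rank (Nstage m 0))%N.
Proof.
move=> lt_mr; have s_gt0 : (0 < r - m)%N by rewrite subn_gt0.
have col_lt (a : 'I_q) : (a * (r - m) + 0 < dim m)%N.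
  by rewrite dKE ltn_addr // ltn_block.
have entry (a j : 'I_q) : Nstage m 0 a (Ordinal (col_lt j))
    = (j`!)%:R^-1 * ('X^a)^`(j).[z].
  by rewrite mxE /= Nstage_T // /taylor_coef mulr1 fact0 invr1 mul1r.
rewrite row_leq_rank; apply: (@row_free_unitrig _ _ _ (fun a => Ordinal (col_lt a))).
  by move=> a; rewrite entry derivnXn subnn ffactnn hornerMn hornerC mulVf ?factr_neq0.
by move=> a j lt_aj; rewrite entry derivnXn ffact_small // mulr0n horner0 mulr0.
Qed.

(** * Exactness and the kernel of the full matrix *)

(** The image of B lies in the kernel of A, whose dimension n - rank A is at most s = rank B, so
    they agree. Transposes turn column spaces into the row spaces of [kermx]. *)
Lemma exact_of_rank n p s t (A : 'M[F]_(p, n)) (B : 'M[F]_(n, s)) (X : 'M[F]_(n, t)) :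
    A *m B = 0 -> \rank B = s -> (n <= \rank A + s)%N -> A *m X = 0 ->
  exists Y, X = B *m Y.
Proof.
move=> AB0 rankB le_n AX0.
have sBK : (B^T <= kermx A^T)%MS by apply/sub_kermxP; rewrite -trmx_mul AB0 trmx0.
have sKB : (kermx A^T <= B^T)%MS.
  by rewrite -(geq_leqif (mxrank_leqif_sup sBK)) mxrank_ker !mxrank_tr rankB; lia.
have sXK : (X^T <= kermx A^T)%MS by apply/sub_kermxP; rewrite -trmx_mul AX0 trmx0.
have /submxP[D def_X] := submx_trans sXK sKB.
by exists D^T; rewrite -[X]trmxK def_X trmx_mul trmxK.
Qed.

Lemma Nstage_exact m t (X : 'M[F]_(dim m, t)) :
  Nstage m 0 *m X = 0 -> exists Y, X = Kbar q r nu z m *m Y.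
Proof.
apply: exact_of_rank (mul_Nstage_Kbar m 0) (rank_Kbar m) _.
case: (ltnP m r) => [lt_mr|le_rm].
  by apply: leq_trans (leq_add (rank_Nstage lt_mr) (leqnn _)); rewrite !dKE; nia.
(* For m >= r, K_m is square, so its rank alone fills the space. *)
by apply: leq_trans (leq_addl _ _); rewrite !dKE; nia.
Qed.

Lemma rank_Kcal i : \rank (Kcal q r nu z i) = dim i.+1.
Proof.
elim: i => [|i IHi]; first exact: rank_Kbar.
rewrite -mxrank_tr; apply: (etrans (congr1 _ (trmx_mul _ _))).
by rewrite mxrankMfree ?mxrank_tr ?rank_Kbar // /row_free mxrank_tr IHi.
Qed.

(** If X = K_0 ... K_i Y, then N^(i+1) X = N_(i+1)^0 Y; its vanishing puts Y in the image of
    K_(i+1). *)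
Lemma Kcal_exact i t (X : 'M[F]_(nu * r, t)) :
    (forall k, (k <= i)%N -> Nk q r nu z k *m X = 0) ->
  exists Y, X = Kcal q r nu z i *m Y.
Proof.
elim: i => [|i IHi] NX0.
  by apply: Nstage_exact; rewrite -Nk_Nstage; apply: NX0.
have [k le_ki|Y def_X] := IHi; first exact/NX0/leqW.
have [|Y' def_Y] := @Nstage_exact i.+1 t Y.
  have <- : Nk q r nu z i.+1 *m Kcal q r nu z i = Nstage i.+1 0.
    by rewrite Nstage_Kcal ltnn subnn.
  by apply: (etrans (esym (mulmxA _ _ _))); rewrite -def_X NX0.
by exists Y'; rewrite def_X def_Y; apply: mulmxA.
Qed.

Lemma Ncal_mul_eq0 mu t (X : 'M[F]_(nu * r, t)) :
  Ncal q r nu z mu *m X = 0 <-> (forall k, (k < mu)%N -> Nk q r nu z k *m X = 0).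
Proof.
split=> [NX0 k lt_k|NX0]; apply/matrixP=> i j.
  have lt_i := ltn_block lt_k (ltn_ord i).
  transitivity ((Ncal q r nu z mu *m X) (Ordinal lt_i) j); last by rewrite NX0 !mxE.
  by rewrite !mxE; apply: eq_bigr => l _; rewrite !mxE /= divn_block ?modn_block.
have lt_k : (i %/ q < mu)%N by rewrite ltn_divLR.
pose a : 'I_q := Ordinal (ltn_pmod i q_gt0).
transitivity ((Nk q r nu z (i %/ q) *m X) a j); last by rewrite NX0 // !mxE.
by rewrite !mxE; apply: eq_bigr => l _; rewrite !mxE.
Qed.

Lemma Kcal_eq_ker mu : (0 < mu)%N ->
  ((Kcal q r nu z mu.-1)^T == kermx (Ncal q r nu z mu)^T)%MS.
Proof.
move=> mu_gt0; apply/andP; split.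
  apply/sub_kermxP; rewrite -trmx_mul; apply/(canLR trmxK); rewrite trmx0.
  apply/Ncal_mul_eq0 => k lt_k; rewrite Nstage_Kcal.
  by rewrite ifT // -ltnS prednK.
(* Exactness is applied to a matrix whose columns span the whole kernel. *)
have [|Y def_ker] := @Kcal_exact mu.-1 _ (kermx (Ncal q r nu z mu)^T)^T.
  move=> k le_k; move: k le_k (prednK mu_gt0) => k + def_mu; rewrite -ltnS def_mu.
  apply: (proj1 (Ncal_mul_eq0 _ _)).
  by apply: trmx_inj; rewrite trmx_mul trmxK mulmx_ker trmx0.
by apply/submxP; exists Y^T; rewrite -[LHS]trmxK def_ker; apply: trmx_mul.
Qed.

End Stage.

Unset Implicit Arguments.
Set Strict Implicit.
Set Printing Implicit Defensive.

Theorem theorem5p8 (R : realType) (q r mu nu : nat) (z : R[i]) :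
  (0 < q)%N -> (0 < r)%N -> (0 < mu)%N -> (0 < nu)%N ->
  (q.+1 <= nu)%N -> (nu <= q + r - 1)%N ->
  [/\ (* (i) *)
      (forall i k : nat, (k <= i)%N -> Nk q r nu z k *m Kcal q r nu z i = 0),
      (* (ii) *)
      ((mu <= r - 1)%N ->
         dK q r nu mu.-1.+1 = (nu * r - q * mu)%N /\
         \rank (Kcal q r nu z mu.-1) = (nu * r - q * mu)%N) /\
      ((r <= mu)%N ->
         dK q r nu mu.-1.+1 = ((nu - q) * r)%N /\
         \rank (Kcal q r nu z mu.-1) = ((nu - q) * r)%N) &
      (* (iii) *)
      [/\ \rank (kermx (Ncal q r nu z mu)^T) = (nu * r - q * minn mu r)%N,
          ((Kcal q r nu z mu.-1)^T == kermx (Ncal q r nu z mu)^T)%MS,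
          \rank (Ncal q r nu z mu) = (q * minn mu r)%N &
          (q * minn mu r < nu * r)%N]].
Proof.
move=> q_gt0 r_gt0 mu_gt0 _ lt_q_nu _.
have dim_mu : dK q r nu mu.-1.+1 = (nu * r - q * minn mu r)%N by rewrite /dK prednK.
have rankK : \rank (Kcal q r nu z mu.-1) = (nu * r - q * minn mu r)%N.
  by rewrite rank_Kcal.
have eq_ker := Kcal_eq_ker z q_gt0 r_gt0 lt_q_nu mu_gt0.
have rank_ker : \rank (kermx (Ncal q r nu z mu)^T) = (nu * r - q * minn mu r)%N.
  by rewrite -(eqmxP eq_ker) mxrank_tr.
have lt_dim : (q * minn mu r < nu * r)%N by nia.
split; first by move=> i k le_ki; rewrite Nstage_Kcal ?le_ki.
split=> [lt_mu_r|le_r_mu]; rewrite rankK dim_mu.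
    by have -> : minn mu r = mu by lia.
  by rewrite (minn_idPr le_r_mu) mulnBl.
split=> //; have := rank_ker; rewrite mxrank_ker mxrank_tr.
(* Rank-nullity equates two truncated subtractions from nu * r; this bound and [lt_dim] allow
   cancellation. *)
by have := rank_leq_col (Ncal q r nu z mu); lia.
Qed.
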